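(* Let $X$, $Y$ and $Z$ be metric spaces, let $s_1, s_2, r \ge 0$, let $f, g : X \to Y$ be $s_1$-Lipschitz maps, and let $h : Z \to X$ be an $s_2$-Lipschitz map. Then $D^{(s_1 s_2)}_r(f \circ h, g \circ h) \le D^{(s_1)}_r(f, g)$.
   Context: For a non-negative integer $m$, $[m] = \{0, 1, \dots, m\}$ carries the metric $d(a,b) = |a-b|$. For $s \ge 0$, a map $\varphi$ between metric spaces is $s$-Lipschitz if $d(\varphi(x), \varphi(x')) \le s\, d(x,x')$ for all $x,x'$. For $s, r \ge 0$ and maps $f, g : X \to Y$ between metric spaces, an $(s,r)$-homotopy between $f$ and $g$ is a map $F : X \times [m] \to Y$, for some non-negative integer $m$, such that (1) $F(x,-) : [m] \to Y$ is $r$-Lipschitz for every $x \in X$; (2) $F(-,i) : X \to Y$ is $s$-Lipschitz for every $i \in [m]$; (3) $F(x,0) = f(x)$ and $F(x,m) = g(x)$ for all $x \in X$. One writes $f \simeq_{(s,r)} g$ if such an $F$ exists. For two $s$-Lipschitz maps $f,g : X \to Y$, the discrete homotopic distance $D^{(s)}_r(f,g)$ is the smallest integer $k \ge 0$ for which there is an open cover $U_0, \dots, U_k$ of $X$ with $f|_{U_i} \simeq_{(s,r)} g|_{U_i}$ (as maps $U_i \to Y$) for all $i = 0, \dots, k$; it is $\infty$ if no such cover exists. *)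

(* Defs.v *)
From HB Require Import structures.
From mathcomp Require Import all_boot all_order all_algebra.
From mathcomp Require Import all_classical all_reals all_analysis.

Set Implicit Arguments.
Unset Strict Implicit.
Unset Printing Implicit Defensive.

Import Order.TTheory GRing.Theory Num.Theory.

Local Open Scope classical_set_scope.
Local Open Scope ring_scope.

(** MathComp-Analysis equips [set_type A], for [A : set X], with the induced
    pseudometric; when [X] is metric, so is [A], for the restricted distance. *)
Section subset_metric.
Context {R : realType} {X : metricType R} (A : set X).

Let dist (x y : A) : R := mdist (set_val x) (set_val y).

Let dist_ge0 x y : 0 <= dist x y.
Proof. exact: mdist_ge0. Qed.

Let dist_positivity x y : dist x y = 0 -> x = y.
Proof. by move=> /mdist_positivity xy; exact: val_inj. Qed.

Let ballEdist (x : A) (e : R) : ball x e = [set y | dist x y < e].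
Proof. by rewrite -initial_ballE ballEmdist. Qed.

HB.instance Definition _ := PseudoMetric_isMetric.Build R (set_type A)
  dist_ge0 dist_positivity ballEdist.

End subset_metric.

(** The space [m] = {0, 1, ..., m}.  The parameter [R], in which the distance
    takes its values, lets the metric structure be inferred. *)
Definition discrete_interval (R : realType) (m : nat) : Type := 'I_m.+1.

Section discrete_interval_metric.
Context {R : realType} (m : nat).

HB.instance Definition _ := Choice.on (discrete_interval R m).

Let dist (a b : discrete_interval R m) : R :=
  `|(nat_of_ord a)%:R - (nat_of_ord b)%:R|.

Let distxx a : dist a a = 0.
Proof. by rewrite /dist subrr normr0. Qed.

Let dist_positivity a b : dist a b = 0 -> a = b.
Proof.
move=> /normr0_eq0/eqP; rewrite subr_eq0 eqr_nat => /eqP ab.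
exact: val_inj.
Qed.

Let dist_sym a b : dist a b = dist b a.
Proof. exact: distrC. Qed.

Let dist_triangle b a c : dist a c <= dist a b + dist b c.
Proof. exact: ler_distD. Qed.

HB.instance Definition _ := isMetric.Build R (discrete_interval R m)
  distxx dist_positivity dist_sym dist_triangle.

End discrete_interval_metric.

(** [k.-lipschitz] of MathComp-Analysis is restricted to normed modules. *)
Definition metric_lipschitz (R : realType) (X Y : metricType R) (s : R)
    (f : X -> Y) : Prop :=
  forall x x' : X, mdist (f x) (f x') <= s * mdist x x'.

Definition homotopy (R : realType) (X Y : metricType R) (s r : R)
    (f g : X -> Y) (m : nat) (F : X * discrete_interval R m -> Y) : Prop :=
  [/\ forall x : X, metric_lipschitz r (fun i => F (x, i)),
      forall i : discrete_interval R m, metric_lipschitz s (fun x => F (x, i)) &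
      forall x : X, F (x, ord0) = f x /\ F (x, ord_max) = g x].

Definition homotopic (R : realType) (X Y : metricType R) (s r : R)
    (f g : X -> Y) : Prop :=
  exists (m : nat) (F : X * discrete_interval R m -> Y), homotopy s r f g F.

(** [sigL A f] is the restriction of [f] to the subspace [A]. *)
Definition homotopic_cover (R : realType) (X Y : metricType R) (s r : R)
    (f g : X -> Y) (k : nat) : Prop :=
  exists U : 'I_k.+1 -> set X,
    [/\ forall i, open (U i),
        \bigcup_i U i = [set: X] &
        forall i, homotopic s r (sigL (U i) f) (sigL (U i) g)].

Definition homotopic_distance (R : realType) (X Y : metricType R) (s r : R)
    (f g : X -> Y) : \bar R :=
  match pselect (exists k, `[< homotopic_cover s r f g k >]) with
  | left ex_cover => ((ex_minn ex_cover)%:R)%:E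
  | right _ => +oo%E
  end.

(* Main.v *)
Require Import Defs.
From mathcomp Require Import all_boot all_order all_algebra.
From mathcomp Require Import all_classical all_reals all_analysis.

(** An open cover of [X] admissible for [f] and [g] pulls back along [h] to an
    open cover of [Z] of the same size, because a Lipschitz map is continuous.
    On each piece [h @^-1` U], the map [h] corestricts to an [s2]-Lipschitz map
    into [U], and precomposing a homotopy of [f] and [g] on [U] with it
    multiplies the Lipschitz constants of the stages by [s2] and leaves the
    paths, hence [r], unchanged ([homotopic_precomp]).  So every [k] admissible
    for [f] and [g] is admissible for [f \o h] and [g \o h]
    ([homotopic_cover_precomp]), and the minimum can only decrease. *)

Set Implicit Arguments.
Unset Strict Implicit.

Import Order.TTheory GRing.Theory Num.Theory.

Local Open Scope classical_set_scope.
Local Open Scope ring_scope.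

Lemma metric_lipschitz_continuous (R : realType) (X Y : metricType R) (s : R)
    (f : X -> Y) :
  0 <= s -> metric_lipschitz s f -> continuous f.
Proof.
move=> s0 lf x; apply/cvg_ballP => e e0.
(* [s + 1] rather than [s], which may vanish *)
have s1_gt0 : 0 < s + 1 by rewrite ltr_wpDl.
apply/nbhs_ballP; exists (e / (s + 1)); first exact: divr_gt0.
move=> y; rewrite !ballEmdist /= ltr_pdivlMr// => xy.
apply: le_lt_trans (lf x y) (le_lt_trans _ xy).
by rewrite mulrC ler_wpM2l ?mdist_ge0// lerDl.
Qed.

Lemma metric_lipschitz_comp (R : realType) (X Y Z : metricType R) (s t : R)
    (f : X -> Y) (h : Z -> X) :
  0 <= s -> metric_lipschitz s f -> metric_lipschitz t h ->
  metric_lipschitz (s * t) (f \o h).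
Proof.
move=> s0 lf lh z z'; apply: le_trans (lf _ _) _.
by rewrite -mulrA ler_wpM2l.
Qed.

Lemma homotopic_precomp (R : realType) (X Y Z : metricType R) (s t r : R)
    (f g : X -> Y) (h : Z -> X) :
  0 <= s -> metric_lipschitz t h -> homotopic s r f g ->
  homotopic (s * t) r (f \o h) (g \o h).
Proof.
move=> s0 lh [m [F [Fpath Fstage Fends]]].
exists m, (fun p => F (h p.1, p.2)); split => [z|i|z].
- exact: Fpath (h z).
- exact: metric_lipschitz_comp s0 (Fstage i) lh.
- exact: Fends (h z).
Qed.

Definition corestrict_preimage {X Z : Type} (h : Z -> X) (U : set X)
    (z : h @^-1` U) : U :=
  SigSub (mem_set (set_valP z) : h (set_val z) \in U).
Arguments corestrict_preimage {X Z} h U z.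

Lemma homotopic_cover_precomp (R : realType) (X Y Z : metricType R)
    (s t r : R) (f g : X -> Y) (h : Z -> X) (k : nat) :
  0 <= s -> 0 <= t -> metric_lipschitz t h ->
  homotopic_cover s r f g k -> homotopic_cover (s * t) r (f \o h) (g \o h) k.
Proof.
move=> s0 t0 lh [U [Uopen Ucover Uhom]].
exists (fun i => h @^-1` U i); split => [i| |i].
- apply: open_comp (Uopen i) => z _.
  exact: metric_lipschitz_continuous lh z.
- by rewrite -preimage_bigcup Ucover preimage_setT.
- have lhU : metric_lipschitz t (corestrict_preimage h (U i)).
    by move=> z z'; exact: lh.
  (* restricting [f \o h] to the preimage is, by computation, composing
     [sigL (U i) f] with the corestriction *)
  exact: homotopic_precomp s0 lhU (Uhom i).
Qed.

Unset Implicit Arguments.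

Theorem proposition4p4 (R : realType) (X Y Z : metricType R) (s1 s2 r : R)
    (f g : X -> Y) (h : Z -> X) :
  0 <= s1 -> 0 <= s2 -> 0 <= r ->
  metric_lipschitz s1 f -> metric_lipschitz s1 g -> metric_lipschitz s2 h ->
  (homotopic_distance (s1 * s2) r (f \o h) (g \o h)
     <= homotopic_distance s1 r f g)%E.
Proof.
move=> s1_ge0 s2_ge0 _ _ _ lh; rewrite {2}/homotopic_distance.
case: pselect => [fg|_]; last exact: leey.
case: ex_minnP => k /asboolP fgk _.
have /asboolP fghk := homotopic_cover_precomp s1_ge0 s2_ge0 lh fgk.
rewrite /homotopic_distance; case: pselect => [fgh|]; last by case; exists k.
by case: ex_minnP => j _ /(_ k fghk) jk; rewrite lee_fin ler_nat.
Qed.
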